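(* For each choice of the sign $\pm$, the Diophantine equation $x^3\pm y^3=a^4+b^4$ has infinitely many nontrivial solutions $(x,y,a,b)$ in positive integers.
   Context: A quadruple $(x,y,a,b)$ of integers is called a nontrivial solution of an equation $x^3\pm y^3=a^k\pm b^k$ (signs fixed) if $\gcd(x,y,a,b)=1$ and no partial sum in the expression $x^3\pm y^3-(a^k\pm b^k)$ vanishes. *)

(* Defs.v *)
From HB Require Import structures.
From mathcomp Require Export all_boot all_order all_algebra.
From mathcomp Require Export classical_sets cardinality.

Set Implicit Arguments.
Unset Strict Implicit.
Unset Printing Implicit Defensive.

Import Order.TTheory GRing.Theory Num.Theory.
Local Open Scope ring_scope.

(* A sign is encoded by a boolean: [(-1) ^+ s] is +1 for [s = false] and -1
   for [s = true].  The signs of the two sides are independent. *)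
Definition is_solution (k : nat) (s t : bool) (x y a b : int) : Prop :=
  x ^+ 3 + (-1) ^+ s * y ^+ 3 = a ^+ k + (-1) ^+ t * b ^+ k.

Definition terms (k : nat) (s t : bool) (x y a b : int) : seq int :=
  [:: x ^+ 3; (-1) ^+ s * y ^+ 3; - a ^+ k; - ((-1) ^+ t * b ^+ k)].

(* A partial sum runs over a nonempty proper subset of the four terms: the
   empty sum is 0, and so is the full sum at every solution. *)
Definition no_vanishing_partial_sum
    (k : nat) (s t : bool) (x y a b : int) : Prop :=
  forall I : {set 'I_4}, I != finset.set0 -> I != [set: 'I_4]%SET ->
    \sum_(i in I) (terms k s t x y a b)`_i != 0.

Definition nontrivial_solution
    (k : nat) (s t : bool) (x y a b : int) : Prop :=
  [/\ is_solution k s t x y a b,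
      gcdz (gcdz x y) (gcdz a b) = 1
    & no_vanishing_partial_sum k s t x y a b].

(* Main.v *)
Require Import Defs.
From mathcomp Require Import all_boot all_order all_algebra.
From mathcomp Require Import classical_sets cardinality.
From mathcomp Require Import zify ring.

Set Implicit Arguments.
Unset Strict Implicit.
Unset Printing Implicit Defensive.

Import Order.TTheory GRing.Theory Num.Theory.

Local Open Scope ring_scope.
Local Open Scope classical_set_scope.

(* Suppose A, B are coprime, A^2 + B^2 = p^2 and 3(A^2 + B^2) - 4AB = 3q^2, and
   put U = A^4 + B^4, V = pq(A - B)^2, g = A^2 - AB + B^2.  Then
   U^2 + 3V^2 = 4g^4, so x = (U + V)/2 and y = (U - V)/2 satisfy
   x^3 + y^3 = U(U^2 + 3V^2)/4 = (gA)^4 + (gB)^4.  Moreover gcd(x, y) = 1, and y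
   has the sign of AB, which decides between the two equations.

   The pairs (A : B) are the rational points of a curve of genus one, a torsor
   under E : Y^2 = X(X - 3)(X + 12).  They come from the points D - R, where
   R = (6, 18) and D is twice a rational point, so that X(D) = u^2/w^2,
   X(D) - 3 = v^2/w^2 and X(D) + 12 = t^2/w^2.  Doubling D repeatedly makes w more
   and more divisible by 2, hence AB unbounded.  Replacing D by -D gives AB > 0 at
   will, and AB < 0 whenever X(D) > 4, which holds for D or for 2D. *)

(** * Preliminaries: infinite sets, parity, divisibility *)

Lemma unbounded_infinite_set (T : eqType) (S : set T) (f : T -> nat) :
  (forall k, exists2 z, S z & (k < f z)%N) -> infinite_set S.
Proof.
move=> unb /finite_seqP[l defS]; have [z Sz] := unb (\max_(i <- l) f i)%N.
by rewrite defS /= in Sz; rewrite ltnNge (leq_bigmax_seq (F := f)).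
Qed.

(** Oddness is written [coprimez 2 x] throughout, so that it passes to products and powers by the
    rules for coprimality. *)
Lemma odd_intP (x : int) : reflect (exists c, x = 2 * c + 1) (coprimez 2 x).
Proof.
apply: (iffP idP) => [cop2x | [c ->]]; last first.
  by apply/coprimezP; exists (- c, 1); rewrite /=; ring.
exists (x %/ 2)%Z; have := divz_eq x 2; have := modz_ge0 x (isT : 2 != 0 :> int).
have := ltz_pmod x (isT : 0 < 2 :> int); set c := (x %/ 2)%Z; set r := (x %% 2)%Z.
move=> r_lt2 r_ge0 def_x; have [r0 | r_neq0] := eqVneq r 0; last by lia.
by move: cop2x; rewrite def_x r0 addr0 coprimezMr /coprimez gcdzz andbF.
Qed.

Lemma odd_intD2 (c x : int) : coprimez 2 (c * 2 + x) = coprimez 2 x.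
Proof. by rewrite /coprimez gcdzMDl. Qed.

Lemma odd_int_neq0 (x : int) : coprimez 2 x -> x != 0.
Proof. by apply: contraTneq => ->. Qed.

Lemma gcdz_decomposition (d e : int) : d != 0 ->
  exists g d' e', [/\ g != 0, d = g * d', e = g * e' & coprimez d' e'].
Proof.
move=> d_neq0; have /dvdzP[d' def_d] := dvdz_gcdl d e.
have /dvdzP[e' def_e] := dvdz_gcdr d e; have [u [v uv]] := Bezoutz d e.
have g_neq0 : gcdz d e != 0 by apply: contra_neq d_neq0 => g0; rewrite def_d g0 mulr0.
exists (gcdz d e), d', e'; split=> //; rewrite 1?[RHS]mulrC //.
apply/coprimezP; exists (u, v); apply: (mulIf g_neq0) => /=.
by rewrite mul1r mulrDl -!mulrA -def_d -def_e.
Qed.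

(** Since 3 is squarefree: after division by the gcd, d'^2 divides 3, which forces |d'| = 1. *)
Lemma dvdz_sqr_mul3 (d q : int) : (d ^+ 2 %| 3 * q ^+ 2)%Z -> (d %| q)%Z.
Proof.
have [-> | d_neq0] := eqVneq d 0.
  by rewrite expr0n /= !dvd0z mulf_eq0 /= expf_eq0.
have [g [d' [q' [g_neq0 -> -> cop]]]] := gcdz_decomposition q d_neq0.
rewrite !exprMn mulrCA dvdz_mul2l ?expf_neq0 // Gauss_dvdzl; last first.
  by rewrite coprimezXl ?coprimezXr.
move=> d'_dv3; apply: dvdz_mul => //.
suff : `|d'|%N = 1%N by rewrite dvdzE => ->.
move: d'_dv3; rewrite dvdzE abszX /=.
by case: `|d'|%N => [|[|m]] // /dvdn_leq-/(_ isT); lia.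
Qed.

(** * From parameters (A, B, p, q) to nontrivial solutions *)

(** Complementary subsets have opposite sums, so only single terms and the three splittings into two
    pairs matter; the last three hypotheses settle the splittings. *)
Lemma no_vanishing_partial_sum_solution (k : nat) (s t : bool) (x y a b : int) :
    is_solution k s t x y a b ->
    x != 0 -> y != 0 -> a != 0 -> b != 0 ->
    a ^+ k + (-1) ^+ t * b ^+ k != 0 ->
    x ^+ 3 != a ^+ k -> x ^+ 3 != (-1) ^+ t * b ^+ k ->
  no_vanishing_partial_sum k s t x y a b.
Proof.
rewrite /is_solution => sol x_neq0 y_neq0 a_neq0 b_neq0 ab xa xb I I_neq0 I_neqT.
have X_neq0 : x ^+ 3 != 0 by rewrite expf_neq0.
have Y_neq0 : (-1) ^+ s * y ^+ 3 != 0 :> int by rewrite mulf_neq0 ?signr_eq0 ?expf_neq0.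
have A_neq0 : a ^+ k != 0 by rewrite expf_neq0.
have B_neq0 : (-1) ^+ t * b ^+ k != 0 :> int by rewrite mulf_neq0 ?signr_eq0 ?expf_neq0.
rewrite big_mkcond /= !big_ord_recl big_ord0 /=.
have /set0Pn[i iI] := I_neq0.
have [j jI] : exists j, j \notin I.
  by apply/existsP; rewrite -negb_forall; apply: contra I_neqT => /forallP Iall;
     apply/eqP/setP=> j; rewrite inE Iall.
have ord4E (P : 'I_4 -> bool) l : P l ->
  [|| P ord0, P (lift ord0 ord0), P (lift ord0 (lift ord0 ord0))
    | P (lift ord0 (lift ord0 (lift ord0 ord0)))].
  case: l => [[|[|[|[|l]]]] lt_l4] // Pl; apply/or4P;
    [constructor 1 | constructor 2 | constructor 3 | constructor 4];
    by congr P: Pl; apply: val_inj.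
move: (ord4E (mem I) i iI) (ord4E (fun j => j \notin I) j jI) => /=.
move: (x ^+ 3) (_ * y ^+ 3) (a ^+ k) (_ * b ^+ k) sol X_neq0 Y_neq0 A_neq0 B_neq0 ab xa xb.
move=> X Y A B sol X_neq0 Y_neq0 A_neq0 B_neq0 ab xa xb.
do 4![case: (_ \in I)] => //= _ _; lia.
Qed.

(** Holds by gcd(u, cu + w) = gcd(u, w). It serves for u = U, w = 2(AB)^2 and f a factor of V. *)
Lemma coprimez_dvdzD (u w f c : int) :
  coprimez u w -> (f %| c * u + w)%Z -> coprimez u f.
Proof.
rewrite /coprimez -(gcdzMDl c) => cop f_dv.
exact: (coprimez_dvdr f_dv cop).
Qed.

(** Oddness of p makes U and V odd, so that (U + V)/2 and (U - V)/2 are integers. The bound on |AB|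
    carries unboundedness over to the solutions. *)
Lemma solution_of_parameters (s : bool) (A B p q : int) :
    coprimez A B -> coprimez 2 p -> 0 < p -> 0 < q ->
    A ^+ 2 + B ^+ 2 = p ^+ 2 ->
    3 * (A ^+ 2 + B ^+ 2) - 4 * (A * B) = 3 * q ^+ 2 ->
    A * B != 0 -> (A * B < 0) = s ->
  exists x y a b : int, [/\ [/\ 0 < x, 0 < y, 0 < a & 0 < b],
    nontrivial_solution 4 s false x y a b & `|A * B| <= a * b].
Proof.
move=> copAB p_odd p_gt0 q_gt0 defp defq AB_neq0 defs.
pose U := A ^+ 4 + B ^+ 4; pose V := p * q * (A - B) ^+ 2.
pose g := A ^+ 2 - A * B + B ^+ 2.
have odd_shift c x y : x = c * 2 + y -> coprimez 2 x = coprimez 2 y.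
  by move=> ->; rewrite odd_intD2.
have U_odd : coprimez 2 U.
  rewrite (odd_shift (- (A ^+ 2 * B ^+ 2)) U (p ^+ 4)) ?coprimezXr //.
  by rewrite /U (exprM p 2 2) -defp; ring.
have q_odd : coprimez 2 q.
  suff: coprimez 2 (3 * q ^+ 2) by rewrite coprimezMr coprimez_pexpr // => /andP[].
  rewrite -defq defp (odd_shift (- 2 * (A * B)) _ (3 * p ^+ 2)); last by ring.
  by rewrite coprimezMr coprimezXr // andbT.
have n_odd : coprimez 2 (A - B).
  rewrite -(@coprimez_pexpr 2) // (odd_shift (- (A * B)) _ (p ^+ 2)) ?coprimezXr //.
  by rewrite -defp; ring.
have V_odd : coprimez 2 V by rewrite /V 2!coprimezMr p_odd q_odd coprimezXr.
have [c defU] := odd_intP _ U_odd; have [e defV] := odd_intP _ V_odd.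
have n_neq0 : A - B != 0 by apply: contraTneq n_odd => ->.
have V_gt0 : 0 < V by apply: mulr_gt0; [exact: mulr_gt0 | rewrite exprn_even_gt0].
have A_neq0 : A != 0 by apply: contra_neq AB_neq0 => ->; rewrite mul0r.
have B_neq0 : B != 0 by apply: contra_neq AB_neq0 => ->; rewrite mulr0.
have U_gt0 : 0 < U by rewrite addr_gt0 // exprn_even_gt0.
have copUW : coprimez U (2 * (A * B) ^+ 2).
  have copU x z : coprimez x z -> coprimez (x ^+ 3 * x + z ^+ 4) x.
    by move=> cop; rewrite coprimez_sym /coprimez gcdzMDl -/(coprimez _ _) coprimezXr.
  rewrite coprimezMr coprimez_sym U_odd /= coprimezXr // coprimezMr; apply/andP; split.
    by rewrite (_ : U = A ^+ 3 * A + B ^+ 4) ?copU // /U; ring.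
  by rewrite (_ : U = B ^+ 3 * B + A ^+ 4) ?copU 1?coprimez_sym // /U; ring.
(* The factors A - B, p and q of V divide, respectively, -U + 2(AB)^2 = -(A^2 - B^2)^2, U + 2(AB)^2
   = p^4, and 9U + 2(AB)^2 = (3(A^2 + B^2) - 4AB)(3(A^2 + B^2) + 4AB). *)
have copUV : coprimez U V.
  rewrite /V 2!coprimezMr coprimezXr ?andbT; last first.
    apply: (coprimez_dvdzD (c := -1) copUW); apply/dvdzP.
    by exists (- (A - B) * (A + B) ^+ 2); rewrite /U; ring.
  apply/andP; split.
    apply: (coprimez_dvdzD (c := 1) copUW); apply/dvdzP; exists (p * p ^+ 2).
    have -> : p * p ^+ 2 * p = (p ^+ 2) ^+ 2 by ring.
    by rewrite -defp /U; ring.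
  apply: (coprimez_dvdzD (c := 9) copUW); apply/dvdzP.
  exists (3 * q * (3 * (A ^+ 2 + B ^+ 2) + 4 * (A * B))).
  have -> : 3 * q * (3 * (A ^+ 2 + B ^+ 2) + 4 * (A * B)) * q =
      3 * q ^+ 2 * (3 * (A ^+ 2 + B ^+ 2) + 4 * (A * B)) by ring.
  by rewrite -defq /U; ring.
(* 12(U^2 - V^2) is AB times a positive factor; as U + V > 0, the sign of U - V is that of AB. *)
have discr : (U - V) * (12 * (U + V)) =
    A * B * (2 * (3 * (A ^+ 2 + B ^+ 2) ^+ 2
      + 4 * (A ^+ 2 + B ^+ 2) * (A - B) ^+ 2 + (A ^+ 2 - B ^+ 2) ^+ 2)
      * (A ^+ 2 + B ^+ 2 + 3 * (A - B) ^+ 2)).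
  have -> : (U - V) * (12 * (U + V)) =
      12 * U ^+ 2 - 4 * (p ^+ 2 * (3 * q ^+ 2)) * (A - B) ^+ 4.
    by rewrite /V; ring.
  by rewrite -defp -defq /U; ring.
(* The form [g1] gives the bound when AB > 0, the form [g2] when AB < 0. *)
have g_gt1 : 1 < g.
  have g1 : g = (A - B) ^+ 2 + A * B by rewrite /g; ring.
  have g2 : g = (A + B) ^+ 2 - 3 * (A * B) by rewrite /g; ring.
  have N_gt0 : 0 < (A - B) ^+ 2 by rewrite exprn_even_gt0.
  have := sqr_ge0 (A + B); move: g1 g2 N_gt0 AB_neq0.
  by move: g ((A - B) ^+ 2) ((A + B) ^+ 2) (A * B); clear; lia.
have UV_gt0 : 0 < 12 * (U + V) by apply: mulr_gt0 => //; exact: addr_gt0.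
have K_gt0 : 0 < 2 * (3 * (A ^+ 2 + B ^+ 2) ^+ 2
      + 4 * (A ^+ 2 + B ^+ 2) * (A - B) ^+ 2 + (A ^+ 2 - B ^+ 2) ^+ 2)
      * (A ^+ 2 + B ^+ 2 + 3 * (A - B) ^+ 2).
  have P_gt0 : 0 < A ^+ 2 + B ^+ 2 by rewrite defp exprn_gt0.
  have N_gt0 : 0 < (A - B) ^+ 2 by rewrite exprn_even_gt0.
  have := sqr_ge0 (A ^+ 2 - B ^+ 2).
  move: (A ^+ 2 + B ^+ 2) ((A - B) ^+ 2) (_ ^+ 2) P_gt0 N_gt0 => P N M P0 N0 M0.
  apply: mulr_gt0; last by rewrite addr_gt0 ?mulr_gt0.
  by rewrite mulr_gt0 // ltr_wpDr // addr_gt0 // mulr_gt0 ?exprn_gt0 // mulr_gt0.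
(* With U = 2c + 1 and V = 2e + 1, c - e is (U - V)/2, and c + e + 1 below is (U + V)/2. *)
pose y : int := (-1) ^+ s * (c - e).
have y_gt0 : 0 < y.
  rewrite /y -defs; have [AB_lt0 | AB_gt0 | AB0] := ltgtP (A * B) 0.
  - have : U - V < 0 by rewrite -(pmulr_llt0 _ UV_gt0) discr pmulr_llt0.
    by rewrite expr1 defU defV; clear; lia.
  - have : 0 < U - V by rewrite -(pmulr_lgt0 _ UV_gt0) discr pmulr_lgt0.
    by rewrite expr0 defU defV; clear; lia.
  by rewrite AB0 eqxx in AB_neq0.
have norm4 (z : int) : (g * `|z|) ^+ 4 = (g * z) ^+ 4.
  by rewrite !exprMn -normrX ger0_norm // exprn_even_ge0.
pose x := c + e + 1; pose a := g * `|A|; pose b := g * `|B|.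
have x_gt0 : 0 < x by rewrite /x; move: U_gt0 V_gt0; rewrite defU defV; clear; lia.
have g_gt0 : 0 < g by exact: lt_trans g_gt1.
have a_gt0 : 0 < a by rewrite /a mulr_gt0 ?normr_gt0.
have b_gt0 : 0 < b by rewrite /b mulr_gt0 ?normr_gt0.
have normUV : U ^+ 2 + 3 * V ^+ 2 = 4 * g ^+ 4.
  have -> : U ^+ 2 + 3 * V ^+ 2 =
      U ^+ 2 + p ^+ 2 * (3 * q ^+ 2) * (A - B) ^+ 4 by rewrite /V; ring.
  by rewrite -defp -defq /U /g; ring.
have sign_y : (-1) ^+ s * y ^+ 3 = (c - e) ^+ 3 by rewrite /y; case: (s); ring.
have sol : is_solution 4 s false x y a b.
  rewrite /is_solution sign_y expr0 mul1r !norm4.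
  apply: (mulfI (isT : 4 != 0 :> int)).
  have -> : 4 * (x ^+ 3 + (c - e) ^+ 3) = U * (U ^+ 2 + 3 * V ^+ 2).
    by rewrite defU defV /x; ring.
  by rewrite normUV /U; ring.
have copxy : coprimez x y.
  have [[i j] /= ij] := coprimezP _ _ copUV.
  apply/coprimezP; exists (i + j, (-1) ^+ s * (i - j)) => /=.
  by rewrite -[RHS]ij defU defV /x /y; case: (s); ring.
(* As g divides a and b, x^3 = a^4 or x^3 = b^4 would give g | x^3, then g | y^3 by the equation,
   against gcd(x, y) = 1 and g > 1. *)
have g_ndvd : ~~ (g %| x ^+ 3)%Z.
  apply/negP => g_dvx.
  have g_dvy : (g %| y ^+ 3)%Z.
    have : (g %| (-1) ^+ s * y ^+ 3)%Z.
      rewrite -(rpredDl _ g_dvx) sol expr0 mul1r.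
      by rewrite rpredD ?dvdz_exp // /a /b dvdz_mulr.
    by case: (s); rewrite ?expr1 ?expr0 ?mul1r // mulN1r rpredN.
  have : coprimez (x ^+ 3) (y ^+ 3) by rewrite coprimezXl ?coprimezXr.
  move=> /(coprimez_dvdl g_dvx)/(coprimez_dvdr g_dvy).
  by rewrite /coprimez gcdzz; move: g_gt1; clear; lia.
exists x, y, a, b; split=> //; last first.
  rewrite /a /b normrM mulrACA ler_peMl ?mulr_ge0 //; move: g_gt1; clear; nia.
split=> //.
  by rewrite (eqP copxy) gcd1z.
apply: no_vanishing_partial_sum_solution sol _ _ _ _ _ _ _; rewrite ?lt0r_neq0 //.
- by rewrite mul1r addr_gt0 ?exprn_gt0.
- by apply: contraNneq g_ndvd => ->; rewrite dvdz_exp // dvdz_mulr.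
- by apply: contraNneq g_ndvd => ->; rewrite mul1r dvdz_exp // dvdz_mulr.
Qed.

(** The gcd d of A and B divides out of the whole system: d^2 divides p^2 and 3q^2, hence d divides
    p and q. *)
Lemma primitive_parameters (A B p q : int) :
    A != 0 -> A ^+ 2 + B ^+ 2 = p ^+ 2 ->
    3 * (A ^+ 2 + B ^+ 2) - 4 * (A * B) = 3 * q ^+ 2 ->
  exists d A' B' p' q' : int,
    [/\ [/\ d != 0, A = d * A', B = d * B', p = d * p' & q = d * q'],
        coprimez A' B', A' ^+ 2 + B' ^+ 2 = p' ^+ 2
      & 3 * (A' ^+ 2 + B' ^+ 2) - 4 * (A' * B') = 3 * q' ^+ 2].
Proof.
move=> A_neq0; have [d [A' [B' [d_neq0 -> -> cop]]]] := gcdz_decomposition B A_neq0.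
move=> defp defq; have /dvdzP[p' p_def] : (d %| p)%Z.
  rewrite -(@dvdz_pexp2r _ _ 2) // -defp; apply/dvdzP.
  by exists (A' ^+ 2 + B' ^+ 2); ring.
have /dvdzP[q' q_def] : (d %| q)%Z.
  apply: dvdz_sqr_mul3; rewrite -defq; apply/dvdzP.
  by exists (3 * (A' ^+ 2 + B' ^+ 2) - 4 * (A' * B')); ring.
have d2_neq0 : d ^+ 2 != 0 by rewrite expf_neq0.
exists d, A', B', p', q'; split=> //.
- by split; rewrite // ?p_def ?q_def mulrC.
- apply: (mulfI d2_neq0); rewrite -exprMn [d * p']mulrC -p_def -defp; ring.
- apply: (mulfI d2_neq0); rewrite [RHS]mulrCA -exprMn [d * q']mulrC -q_def -defq; ring.
Qed.

(** * Points of the elliptic curve and their doubling *)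

(* [u ^+ 2 / w ^+ 2] is the abscissa of a rational point of
   Y^2 = X (X - 3) (X + 12) lying in 2E(Q), and [2 ^+ k.+1 %| w] says that the
   point is 2-adically close to the origin. *)
Definition curve_point (k : nat) (u v t w : int) : Prop :=
  [/\ v ^+ 2 = u ^+ 2 - 3 * w ^+ 2, t ^+ 2 = u ^+ 2 + 12 * w ^+ 2,
      coprimez 2 u, w != 0 & (2 ^+ k.+1 %| w)%Z].

Lemma curve_point_odd (k : nat) (u v t w : int) :
  curve_point k u v t w -> [/\ coprimez 2 v, coprimez 2 t & (2 %| w)%Z].
Proof.
case=> defv deft u_odd _ w_dv.
have w_even : (2 %| w)%Z by apply: dvdz_trans w_dv; rewrite exprS dvdz_mulr.
have /dvdzP[r defw] := w_even; split=> //; rewrite -(@coprimez_pexpr 2) //.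
  have -> : v ^+ 2 = (- 6 * r ^+ 2) * 2 + u ^+ 2 by rewrite defv defw; ring.
  by rewrite odd_intD2 coprimezXr.
have -> : t ^+ 2 = (24 * r ^+ 2) * 2 + u ^+ 2 by rewrite deft defw; ring.
by rewrite odd_intD2 coprimezXr.
Qed.

(** Duplication formula: X(2P) - e = ((X - e)^2 - (e - e')(e - e''))^2 / (4Y^2) for the roots e, e',
    e'' of the cubic; the product (e - e')(e - e'') is -36, 45, 180 for e = 0, 3, -12. The factor 2
    in the new w supplies the extra power of 2. *)
Lemma curve_point_double (k : nat) (u v t w : int) :
    curve_point k u v t w ->
  curve_point k.+1 (u ^+ 4 + 36 * w ^+ 4) (v ^+ 4 - 45 * w ^+ 4)
    (t ^+ 4 - 180 * w ^+ 4) (2 * (u * v * t * w)).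
Proof.
move=> uvtw; have [v_odd t_odd _] := curve_point_odd uvtw.
have [defv deft u_odd w_neq0 /dvdzP[r defw]] := uvtw; split.
- have -> : 3 * (2 * (u * v * t * w)) ^+ 2 =
      12 * u ^+ 2 * v ^+ 2 * t ^+ 2 * w ^+ 2 by ring.
  by rewrite (exprM v 2 2) defv deft; ring.
- have -> : 12 * (2 * (u * v * t * w)) ^+ 2 =
      48 * u ^+ 2 * v ^+ 2 * t ^+ 2 * w ^+ 2 by ring.
  by rewrite (exprM t 2 2) defv deft; ring.
- have -> : u ^+ 4 + 36 * w ^+ 4 = (18 * w ^+ 4) * 2 + u ^+ 4 by ring.
  by rewrite odd_intD2 coprimezXr.
- by rewrite !mulf_eq0 !negb_or w_neq0 (odd_int_neq0 u_odd) (odd_int_neq0 v_odd)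
    (odd_int_neq0 t_odd).
- by apply/dvdzP; exists (u * v * t * r); rewrite {1}defw [in RHS]exprS; ring.
Qed.

Lemma curve_point_exists (k : nat) : exists u v t w, curve_point k u v t w.
Proof.
elim: k => [|k [u [v [t [w uvtw]]]]]; first by exists 13, 11, 19, 4.
(* The starting abscissa 169/16 is that of 4R; 2R has abscissa 4, where u = 2 is even. *)
by do 4!eexists; apply: curve_point_double uvtw.
Qed.

(* The abscissa X of a point with 3 < X <= 4 becomes larger than 4 under
   doubling. *)
Lemma curve_point_gt4 (k : nat) : exists u v t w,
  curve_point k u v t w /\ 4 * w ^+ 2 < u ^+ 2.
Proof.
have [u [v [t [w uvtw]]]] := curve_point_exists k.
have [gt4 | le4] := ltP (4 * w ^+ 2) (u ^+ 2); first by exists u, v, t, w.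
have [defv deft u_odd w_neq0 w_dv] := uvtw.
have [] := curve_point_double uvtw.
set u' := u ^+ 4 + _; set w' := 2 * _; set v' := v ^+ 4 - _; set t' := t ^+ 4 - _.
move=> defv' deft' u'_odd w'_neq0 w'_dv; exists u', v', t', w'; split.
  by split=> //; apply: dvdz_trans w'_dv; rewrite dvdz_exp2l.
have -> : 4 * w' ^+ 2 = 16 * (u ^+ 2 * w ^+ 2) * (v ^+ 2 * t ^+ 2) by rewrite /w'; ring.
rewrite /u' (exprM u 2 2) (exprM w 2 2) deft defv.
have := sqr_ge0 v; rewrite defv subr_ge0.
have : 0 < w ^+ 2 by rewrite exprn_even_gt0.
move: (u ^+ 2) (w ^+ 2) le4; clear => a b le4 b_gt0 ge3.
have b_ge0 := ltW b_gt0; have a_ge0 : 0 <= a by apply: le_trans ge3; rewrite mulr_ge0.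
(* With a = u^2, b = w^2 and 3b <= a <= 4b, the chain is: left side <= 1024 b^4 < 2025 b^4 = (45
   b^2)^2 <= (a^2 + 36 b^2)^2. *)
apply: (@le_lt_trans _ _ (1024 * b ^+ 4)).
  have -> : 1024 * b ^+ 4 = 16 * (4 * b * b) * (b * (16 * b)) by ring.
  rewrite ler_pM ?mulr_ge0 ?subr_ge0 ?addr_ge0 ?mulr_ge0 //.
    by rewrite ler_pM2l // ler_wpM2r.
  by rewrite ler_pM ?subr_ge0 ?addr_ge0 ?mulr_ge0 //; lia.
apply: (@lt_le_trans _ _ ((45 * b ^+ 2) ^+ 2)).
  by rewrite exprMn -exprM ltr_pM2r ?exprn_gt0.
rewrite lerXn2r ?nnegrE ?addr_ge0 ?mulr_ge0 ?exprn_ge0 //.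
have -> : 45 * b ^+ 2 = (3 * b) ^+ 2 + 36 * b ^+ 2 by ring.
by rewrite lerD2r lerXn2r ?nnegrE ?mulr_ge0.
Qed.

(** * From points of the curve to parameters *)

Lemma parameters_exist (s : bool) (k : nat) : exists A B p q : int,
  [/\ [/\ coprimez A B, coprimez 2 p, 0 < p & 0 < q],
      A ^+ 2 + B ^+ 2 = p ^+ 2, 3 * (A ^+ 2 + B ^+ 2) - 4 * (A * B) = 3 * q ^+ 2,
      (A * B < 0) = s & k%:Z < `|A * B|].
Proof.
have [u [v0 [t [w [uv0tw gt4]]]]] := curve_point_gt4 k.
(* Changing v to -v replaces D by -D and flips the sign of uvtw. *)
have [v defz uvtw] : exists2 v, (0 < u * v * t * w) = s & curve_point k u v t w.
  have [v0_odd t_odd _] := curve_point_odd uv0tw; case: (uv0tw) => _ _ u_odd w_neq0 _.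
  have z_neq0 : u * v0 * t * w != 0.
    by rewrite !mulf_eq0 !negb_or w_neq0 !odd_int_neq0.
  have [/eqP <- | sz] := boolP ((0 < u * v0 * t * w) == s); first by exists v0.
  exists (- v0); last by case: uv0tw => defv0 deft; split; rewrite // sqrrN.
  rewrite mulrN !mulNr oppr_gt0; move: sz.
  by case: ltgtP z_neq0; case: (s).
have [v_odd t_odd /dvdzP[r defw]] := curve_point_odd uvtw.
have [defv deft u_odd w_neq0 w_dv] := uvtw.
have [[i defu] [j deft']] := (odd_intP _ u_odd, odd_intP _ t_odd).
(* For D = (u^2/w^2, -uvt/w^3), the chord formula gives X(D - R) = 6(p/n)^2, X(D - R) - 3 = 3(m/n)^2
   and X(D - R) + 12 = 18(q/n)^2. *)
pose n := 6 * w ^+ 2 - u ^+ 2; pose m := u * t - 6 * v * w.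
pose p := v * t - 3 * u * w; pose q := u * v - t * w.
(* A = (m + n)/2 and B = (m - n)/2, written without division through u = 2i + 1 and t = 2j + 1. *)
pose A := u * (j - i) - 3 * v * w + 3 * w ^+ 2.
pose B := u * (i + j + 1) - 3 * v * w - 3 * w ^+ 2.
have defA : 2 * A = m + n by rewrite /A /m /n deft' defu; ring.
have defB : 2 * B = m - n by rewrite /B /m /n deft' defu; ring.
have mnp : m ^+ 2 + n ^+ 2 = 2 * p ^+ 2.
  have -> : m ^+ 2 = u ^+ 2 * t ^+ 2 + 36 * v ^+ 2 * w ^+ 2 - 12 * (u * v * t * w).
    by rewrite /m; ring.
  have -> : p ^+ 2 = v ^+ 2 * t ^+ 2 + 9 * u ^+ 2 * w ^+ 2 - 6 * (u * v * t * w).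
    by rewrite /p; ring.
  by rewrite /n defv deft; ring.
have pnq : p ^+ 2 + 2 * n ^+ 2 = 3 * q ^+ 2.
  have -> : q ^+ 2 = u ^+ 2 * v ^+ 2 + t ^+ 2 * w ^+ 2 - 2 * (u * v * t * w).
    by rewrite /q; ring.
  have -> : p ^+ 2 = v ^+ 2 * t ^+ 2 + 9 * u ^+ 2 * w ^+ 2 - 6 * (u * v * t * w).
    by rewrite /p; ring.
  by rewrite /n defv deft; ring.
have four_neq0 : 4 != 0 :> int by [].
have ABp : A ^+ 2 + B ^+ 2 = p ^+ 2.
  apply: (mulfI four_neq0).
  have -> : 4 * (A ^+ 2 + B ^+ 2) = (2 * A) ^+ 2 + (2 * B) ^+ 2 by ring.
  have -> : 4 * p ^+ 2 = 2 * (2 * p ^+ 2) by ring.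
  by rewrite -mnp defA defB; ring.
have ABE : 4 * (A * B) = m ^+ 2 - n ^+ 2.
  have -> : 4 * (A * B) = 2 * A * (2 * B) by ring.
  by rewrite defA defB; ring.
have ABq : 3 * (A ^+ 2 + B ^+ 2) - 4 * (A * B) = 3 * q ^+ 2.
  rewrite ABp ABE -pnq; apply/eqP; rewrite -subr_eq0; apply/eqP.
  have -> : 3 * p ^+ 2 - (m ^+ 2 - n ^+ 2) - (p ^+ 2 + 2 * n ^+ 2) =
      2 * p ^+ 2 - (m ^+ 2 + n ^+ 2) by ring.
  by rewrite mnp subrr.
have ABw : A * B = 3 * (w ^+ 2 * (5 * u ^+ 2 - 12 * w ^+ 2) - u * v * t * w).
  apply: (mulfI four_neq0); rewrite ABE.
  have -> : m ^+ 2 = u ^+ 2 * t ^+ 2 + 36 * v ^+ 2 * w ^+ 2 - 12 * (u * v * t * w).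
    by rewrite /m; ring.
  by rewrite /n defv deft; ring.
have w2_gt0 : 0 < w ^+ 2 by rewrite exprn_even_gt0.
have Y_gt0 : 0 < w ^+ 2 * (5 * u ^+ 2 - 12 * w ^+ 2).
  rewrite mulr_gt0 //; move: (u ^+ 2) (w ^+ 2) gt4 w2_gt0; clear; lia.
have u6w : u ^+ 2 - 6 * w ^+ 2 != 0.
  rewrite odd_int_neq0 // (_ : _ - _ = (- 3 * w ^+ 2) * 2 + u ^+ 2); last by ring.
  by rewrite odd_intD2 coprimezXr.
(* (uvtw)^2 exceeds the square of the positive w^2(5u^2 - 12w^2) by w^2(u^2 - 6w^2)^2(u^2 - 4w^2) >
   0, so AB < 0 exactly when uvtw > 0. *)
have AB_sign : (A * B < 0) = s.
  rewrite ABw pmulr_rlt0 // subr_lt0 -defz.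
  have [z_gt0 | z_le0] := ltP 0 (u * v * t * w); last first.
    by apply/negbTE; rewrite -leNgt (le_trans z_le0) // ltW.
  rewrite -(@ltr_pXn2r _ 2) ?nnegrE ?ltW // -subr_gt0.
  have -> : (u * v * t * w) ^+ 2 = u ^+ 2 * v ^+ 2 * t ^+ 2 * w ^+ 2 by ring.
  have -> : u ^+ 2 * v ^+ 2 * t ^+ 2 * w ^+ 2 - (w ^+ 2 * (5 * u ^+ 2 - 12 * w ^+ 2)) ^+ 2 =
      w ^+ 2 * (u ^+ 2 - 6 * w ^+ 2) ^+ 2 * (u ^+ 2 - 4 * w ^+ 2).
    by rewrite defv deft; ring.
  by rewrite mulr_gt0 ?subr_gt0 // mulr_gt0 // exprn_even_gt0.
have AB_neq0 : A * B != 0.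
  have [/ltr0_neq0 // | ] := boolP (A * B < 0); rewrite AB_sign -defz -leNgt => z_le0.
  by rewrite lt0r_neq0 // ABw mulr_gt0 // subr_gt0 (le_lt_trans z_le0).
have p_odd : coprimez 2 p.
  rewrite /p defw (_ : _ - _ = (- 3 * u * r) * 2 + v * t); last by ring.
  by rewrite odd_intD2 coprimezMr v_odd.
have q_odd : coprimez 2 q.
  rewrite /q defw (_ : _ - _ = (- t * r) * 2 + u * v); last by ring.
  by rewrite odd_intD2 coprimezMr u_odd.
have A_neq0 : A != 0 by apply: contra_neq AB_neq0 => ->; rewrite mul0r.
have [d [A' [B' [p' [q' [[d_neq0 dA dB dp dq] cop ABp' ABq']]]]]] :=
  primitive_parameters A_neq0 ABp ABq.
have ABd : A * B = d ^+ 2 * (A' * B') by rewrite dA dB; ring.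
have [d_odd p'_odd] : coprimez 2 d /\ coprimez 2 p'.
  by apply/andP; rewrite -coprimezMr -dp.
have norm2 (x : int) : `|x| ^+ 2 = x ^+ 2 by rewrite real_normK ?num_real.
exists A', B', `|p'|, `|q'|; rewrite !norm2; split=> //.
- split=> //; rewrite ?normr_gt0 ?(odd_int_neq0 p'_odd) //.
  by apply: contraTneq q_odd => q'0; rewrite dq q'0 mulr0.
- by rewrite -AB_sign ABd [RHS]pmulr_rlt0 // exprn_even_gt0.
(* AB is a multiple of w, and d is odd as a divisor of the odd p, so the power of 2 survives in
   A'B'; hence |A'B'| >= 2^(k+1) > k. *)
have : (2 ^+ k.+1 %| A' * B')%Z.
  have cop2d : coprimez (2 ^+ k.+1) (d ^+ 2) by rewrite coprimezXl ?coprimezXr.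
  rewrite -(Gauss_dvdzr _ cop2d) -ABd ABw; apply: dvdz_trans w_dv _.
  by apply/dvdzP; exists (3 * (w * (5 * u ^+ 2 - 12 * w ^+ 2) - u * v * t)); ring.
have AB'_neq0 : A' * B' != 0 by apply: contra_neq AB_neq0; rewrite ABd => ->; rewrite mulr0.
move: (A' * B') AB'_neq0; clear => z z_neq0; rewrite dvdzE abszX => /dvdn_leq.
rewrite absz_gt0 => /(_ z_neq0) le2k; rewrite -abszE ltz_nat.
by apply: leq_trans le2k; apply: ltnW; apply: ltn_expl.
Qed.

Theorem mainTheorem3 (s : bool) :
  infinite_set [set q : int * int * int * int |
    let: (x, y, a, b) := q in
    [/\ 0 < x, 0 < y, 0 < a & 0 < b] /\
    nontrivial_solution 4 s false x y a b].
Proof.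
(* The quantity shown to be unbounded on the solutions is ab. *)
apply: (@unbounded_infinite_set (int * int * int * int)%type _
  (fun z : int * int * int * int => absz (z.1.2 * z.2))) => k.
have [A [B [p [q [[cop p_odd p_gt0 q_gt0] defp defq AB_sign AB_gt]]]]] :=
  parameters_exist s k.
have AB_neq0 : A * B != 0 by rewrite -normr_gt0 (le_lt_trans _ AB_gt).
have [x [y [a [b [pos sol le_ab]]]]] :=
  solution_of_parameters cop p_odd p_gt0 q_gt0 defp defq AB_neq0 AB_sign.
exists (x, y, a, b) => //=; rewrite -ltz_nat abszE.
by apply: lt_le_trans AB_gt (le_trans le_ab (ler_norm _)).
Qed.
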